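(* For every $n\ge2$, \[\sum_{\pi\in\mathcal{A}_n}\mathbf{x}^{\mathrm{cDes}(\pi)}=\sum_{k=0}^{n-2}\ \sum_{T\in\mathrm{SYT}((n-k-1,1^k)\oplus(1))}\mathbf{x}^{\mathrm{cDes}(T)}.\]
   Context: $\mathcal{A}_n$ is the set of arc permutations: $\pi\in\mathfrak{S}_n$ (one-line notation) such that for every $1\le j\le n$, $\{\pi(1),\dots,\pi(j)\}$ is an interval in $\mathbb{Z}_n$ (a set of cyclically consecutive residues). For $\pi\in\mathfrak{S}_n$, $\mathrm{cDes}(\pi)=\{i\in[n]:\pi(i)>\pi(i+1)\}$ with $\pi(n+1):=\pi(1)$, and $\mathbf{x}^J=\prod_{i\in J}x_i$. The skew shape $(n-k-1,1^k)\oplus(1)$ consists of two connected components: the hook $(n-k-1,1^k)$ and a single cell placed strictly northeast of it (in a row above and a column to the right of all cells of the hook). A standard Young tableau $T$ of this shape (English notation: rows and columns increasing) has descent set $\mathrm{Des}(T)$, the set of $i\in[n-1]$ such that $i+1$ is in a strictly lower row than $i$, and cyclic descent set $\mathrm{cDes}(T)=\mathrm{Des}(T)\cup\{n\}$ if $|\mathrm{Des}(T)|=k$, and $\mathrm{cDes}(T)=\mathrm{Des}(T)$ otherwise. *)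

(* Defs.v *)
From HB Require Import structures.
From mathcomp Require Import all_boot all_order all_algebra all_fingroup.
From mathcomp Require Import mpoly.
Set Implicit Arguments. Unset Strict Implicit. Unset Printing Implicit Defensive.
Import GRing.Theory.
Local Open Scope ring_scope.

(* Conventions: [n] = {1..n} is encoded by 'I_n via i |-> i-1; a permutation
   pi of [n] in one-line notation is a {perm 'I_n} (position p, value pi p,
   both shifted by 1).  The variable x_i (i in [n]) is 'X_(i-1). *)

Definition xJ (n : nat) (J : {set 'I_n}) : {mpoly int[n]} :=
  \prod_(i in J) 'X_i.

Definition cyc_interval (n j : nat) (a : 'I_n) : {set 'I_n} :=
  [set x : 'I_n | ((x + n - a) %% n < j)%N].

Definition is_arc (n : nat) (pi : 'S_n) : bool :=
  [forall j : 'I_n.+1, (0 < j)%N ==>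
     [exists a : 'I_n, [set pi p | p : 'I_n & (p < j)%N] == @cyc_interval n j a]].

Definition cDes_perm (n : nat) (pi : 'S_n) : {set 'I_n} :=
  [set p : 'I_n | (pi (ordS p) < pi p)%N].

(* Cells (row, column), rows numbered top to bottom, columns left to right
   (English notation). *)
Definition cell := (nat * nat)%type.

(* The skew shape (n-k-1, 1^k) (+) (1): the hook occupies rows 1..k+1 and
   columns 0..n-k-2, the single cell sits at row 0, column n-k-1 (strictly
   north-east of the hook). *)
Definition hook_plus_cell (n k : nat) : seq cell :=
  (0%N, (n - k - 1)%N) ::
  [seq (1%N, c) | c <- iota 0 (n - k - 1)] ++
  [seq (r, 0%N) | r <- iota 2 k].

(* A filling of a shape is given by a sequence s of cells: s`_a is the cell
   containing the entry a+1.  It is a standard Young tableau of the shape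
   iff s is an enumeration of the cells (without repetition) and rows and
   columns increase. *)
Definition is_standard (cells s : seq cell) : bool :=
  perm_eq s cells &&
  [forall a : 'I_(size s), forall b : 'I_(size s),
     let ca := nth (0%N, 0%N) s a in let cb := nth (0%N, 0%N) s b in
     (((ca.1 == cb.1) && (ca.2 < cb.2)%N) ==> (a < b)%N) &&
     (((ca.2 == cb.2) && (ca.1 < cb.1)%N) ==> (a < b)%N)].

Definition SYT (cells : seq cell) : seq (seq cell) :=
  [seq s <- permutations cells | is_standard cells s].

(* Des(T) in 0-based form: a (i.e. i = a+1 in [n-1]) such that the entry
   a+2 lies in a strictly lower row than a+1. *)
Definition Des_tab (s : seq cell) : seq nat :=
  [seq a <- iota 0 (size s).-1 |
     ((nth (0%N, 0%N) s a).1 < (nth (0%N, 0%N) s a.+1).1)%N].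

Definition cDes_tab (n k : nat) (s : seq cell) : {set 'I_n} :=
  [set a : 'I_n | ((a : nat) \in Des_tab s) ||
                  (((a : nat) == n.-1) && (size (Des_tab s) == k))].

(* Main.v *)
Require Import Defs.
From HB Require Import structures.
From mathcomp Require Import all_boot all_order all_algebra all_fingroup.
From mathcomp Require Import mpoly.
From mathcomp Require Import zify.
Set Implicit Arguments.
Unset Strict Implicit.
Unset Printing Implicit Defensive.

(** Both sides equal the sum of x^J over the pairs (c, J) with c in J and c - 1
    (cyclically) not in J.

    An arc permutation pi is sent to the position c of its maximum and to
    J = cDes(pi).  A cyclic interval or its complement is an interval avoiding
    the maximal value; so pi is an arc permutation iff the values before any
    position r <= c lie on one side of pi(r), and likewise the values after any
    position p >= c lie on one side of pi(p).  Hence every comparison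
    pi(i) < pi(j), i < j, reduces to one of cyclically adjacent positions, that
    is, to a membership in J: of j - 1 if j <= c, of i if c <= i, and of n if
    i < c < j.  For every (c, J) these rules are realized by explicit integer
    keys, and pi is the standardization of the keys.

    A tableau T is sent to the entry c of the isolated cell and to J = cDes(T).
    It is a shuffle of three chains of cells, hence determined by c and the set
    L of entries of the leg.  With tau the transposition of c and n,
    cDes(T) = {c} U {i : tau(i) + 1 in L}: thus L is recovered from (c, J), the
    set J has k + 1 elements, and summing over k exhausts all (c, J). *)

Local Open Scope nat_scope.

Lemma big_inj_image (R : Type) (idx : R) (op : Monoid.com_law idx)
    (I : eqType) (J : finType) (r : seq I) (P : pred J) (f : I -> J)
    (F : J -> R) :
  uniq r -> {in r &, injective f} ->
  (forall j, reflect (exists2 i, i \in r & j = f i) (P j)) ->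
  \big[op/idx]_(i <- r) F (f i) = \big[op/idx]_(j | P j) F j.
Proof.
move=> r_uniq f_inj imP; rewrite -[RHS]big_enum -(big_map f predT F).
apply/perm_big/uniq_perm; rewrite ?enum_uniq ?map_inj_in_uniq // => j.
by rewrite mem_enum; apply/mapP/imP.
Qed.

Lemma map_eq_nseq (T U : eqType) (f : T -> U) (y : U) (s : seq T) :
  {in s, forall x, f x = y} -> map f s = nseq (size s) y.
Proof.
move=> eq_f; rewrite -(size_map f); apply/all_pred1P; rewrite all_map.
by apply/allP => x /eq_f /= ->.
Qed.

Lemma card_ord_lt (n k : nat) : k <= n -> #|[set i : 'I_n | i < k]| = k.
Proof.
move=> le_kn; rewrite cardsE -sum1_card.
by rewrite (big_ord_narrow le_kn) sum1_card card_ord.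
Qed.

Lemma card_ord_notin (n : nat) (A : {set 'I_n}) (i : 'I_n) :
  i \notin A -> #|A| < n.
Proof.
move=> iA; rewrite -[X in _ < X]card_ord; apply/proper_card/properP.
by split; [exact: subset_predT | exists i].
Qed.

(** * Permutations and cyclic successors *)

Lemma perm_gtE (n : nat) (pi : 'S_n) (i j : 'I_n) :
  i < j -> (pi j < pi i) = ~~ (pi i < pi j).
Proof.
move=> lt_ij; rewrite -leqNgt [RHS]leq_eqVlt val_eqE (inj_eq perm_inj) -val_eqE.
by rewrite gtn_eqF.
Qed.

Lemma perm_lt_inj (n : nat) (pi sigma : 'S_n) :
  (forall i j : 'I_n, i < j -> (pi i < pi j) = (sigma i < sigma j)) ->
  pi = sigma.
Proof.
move=> eq_lt_incr.
have eq_lt (i j : 'I_n) : (pi i < pi j) = (sigma i < sigma j).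
  case: (ltngtP i j) => [/eq_lt_incr //|lt_ji|/val_inj ->].
    by rewrite 2?[_ < _ i](perm_gtE _ lt_ji) eq_lt_incr.
  by rewrite !ltnn.
apply/permP => i; apply: val_inj => /=.
have rank (tau : 'S_n) : tau i = #|[set j | tau j < tau i]| :> nat.
  rewrite -[LHS](card_ord_lt (ltnW (ltn_ord (tau i)))).
  rewrite -[LHS](card_preimset _ (@perm_inj _ tau)).
  by apply: eq_card => j; rewrite !inE.
by rewrite rank [RHS]rank; apply: eq_card => j; rewrite !inE eq_lt.
Qed.

Lemma exists_standardization (n : nat) (f : 'I_n -> nat) : injective f ->
  exists pi : 'S_n, forall i j, (pi i < pi j) = (f i < f j).
Proof.
move=> f_inj; pose below i := [set j | f j < f i].
have below_homo i j : f i < f j -> #|below i| < #|below j|.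
  move=> lt_ij; apply/proper_card/properP; split.
    by apply/subsetP => l; rewrite !inE => /ltn_trans; apply.
  by exists i; rewrite !inE ?ltnn.
have below_mono i j : (#|below i| < #|below j|) = (f i < f j).
  case: (ltngtP (f i) (f j)) => [/below_homo //|/below_homo|/f_inj ->].
    by case: ltngtP.
  by rewrite ltnn.
have rank_lt i : #|below i| < n.
  by apply: (@card_ord_notin _ _ i); rewrite inE ltnn.
have rank_inj : injective (fun i => Ordinal (rank_lt i)).
  move=> i j [eq_ij]; apply: f_inj.
  by move: (below_mono i j) (below_mono j i); rewrite eq_ij ltnn; case: ltngtP.
by exists (perm rank_inj) => i j; rewrite !permE; apply: below_mono.
Qed.

Lemma perm_eq_max (n : nat) (pi : 'S_n.+1) (c : 'I_n.+1) :
  (forall i, i != c -> pi i < pi c) -> pi c = ord_max.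
Proof.
move=> lt_c; rewrite -(permKV pi ord_max); congr (pi _); apply/eqP/negPn/negP.
by rewrite eq_sym => /lt_c; rewrite permKV ltnNge leq_ord.
Qed.

Lemma val_ordS (n : nat) (i : 'I_n.+1) :
  ordS i = (if i == n :> nat then 0 else i.+1) :> nat.
Proof.
rewrite /=; case: eqVneq => [->|ne_in]; first exact: modnn.
by rewrite modn_small // ltnS ltn_neqAle ne_in leq_ord.
Qed.

Lemma val_ordS_neq_max (n : nat) (i : 'I_n.+1) :
  i != ord_max -> ordS i = i.+1 :> nat.
Proof. by rewrite val_ordS -val_eqE => /negbTE /= ->. Qed.

Lemma ordS_neq (n : nat) (i : 'I_n.+1) : 0 < n -> ordS i != i.
Proof.
move=> n_gt0; apply/eqP => /(congr1 (@nat_of_ord n.+1)).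
by rewrite val_ordS; case: eqVneq; lia.
Qed.

Lemma ordS_max (n : nat) : ordS (@ord_max n) = ord0.
Proof. by apply: ord_inj; rewrite val_ordS eqxx. Qed.

Lemma ord_pred0 (n : nat) : ord_pred (@ord0 n) = ord_max.
Proof. by rewrite -ordS_max ordSK. Qed.

Lemma ordS_eq0 (n : nat) (i : 'I_n.+1) : (ordS i == ord0) = (i == ord_max).
Proof. by rewrite -ordS_max (inj_eq (@ordS_inj _)). Qed.

Lemma ord_pred_eq_max (n : nat) (i : 'I_n.+1) :
  (ord_pred i == ord_max) = (i == ord0).
Proof. by rewrite -ordS_eq0 ord_predK. Qed.

Lemma val_ord_pred_gt0 (n : nat) (i : 'I_n.+1) :
  0 < i -> ord_pred i = i.-1 :> nat.
Proof.
move=> i_gt0; rewrite -[in RHS](ord_predK i) val_ordS_neq_max //.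
by rewrite ord_pred_eq_max -val_eqE -lt0n.
Qed.

(** * Cyclic intervals *)

Section CyclicIntervals.
Variable n : nat.
Implicit Types (a x y z : 'I_n.+1) (A : {set 'I_n.+1}).

(* No point outside [A] separates two points of [A]. *)
Definition ord_interval A : Prop :=
  forall x y z, x \notin A -> y \in A -> z \in A -> (y < x) = (z < x).

Definition cyclic_interval A : Prop := exists a, A = cyc_interval #|A| a.

Lemma in_cyc_interval k a x : (x \in cyc_interval k a) =
  if a <= x then x - a < k else x + n.+1 - a < k.
Proof.
rewrite inE; have [lt_an lt_xn] := (ltn_ord a, ltn_ord x).
case: (leqP a x) => le_ax; last by rewrite modn_small //; lia.
by rewrite -addnBAC // modnDr modn_small //; lia.
Qed.

Lemma card_cyc_interval k a : k <= n.+1 -> #|cyc_interval k a| = k.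
Proof.
move=> le_kn.
pose shift x : 'I_n.+1 := Ordinal (ltn_pmod (x + n.+1 - a) (ltn0Sn n)).
have shift_inj : injective shift.
  move=> x y [/eqP]; have [lt_an lt_xn] := (ltn_ord a, ltn_ord x).
  rewrite -!addnBA; try lia.
  by rewrite eqn_modDr !modn_small ?ltn_ord // => /eqP/val_inj.
rewrite -[RHS](card_ord_lt le_kn) -(card_preimset _ shift_inj).
by apply: eq_card => x; rewrite !inE.
Qed.

Lemma cyclic_intervalI k a A :
  k <= n.+1 -> A = cyc_interval k a -> cyclic_interval A.
Proof. by move=> le_kn eA; exists a; rewrite eA card_cyc_interval. Qed.

Lemma cyclic_intervalC A : cyclic_interval A -> cyclic_interval (~: A).
Proof.
case=> a eA; set k := #|A| in eA.
have le_kn : k <= n.+1 by rewrite -[X in _ <= X]card_ord max_card.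
pose b := if a + k < n.+1 then a + k else a + k - n.+1.
have lt_bn : b < n.+1.
  by rewrite /b; have := ltn_ord a; case: (ltnP (a + k) n.+1); lia.
apply: (@cyclic_intervalI (n.+1 - k) (Ordinal lt_bn)); first exact: leq_subr.
apply/setP => x; rewrite in_setC eA !in_cyc_interval /=.
have [lt_an lt_xn] := (ltn_ord a, ltn_ord x); rewrite /b.
by case: (ltnP (a + k) n.+1) => ?; case: (leqP a x) => ?; case: ifP => ?; lia.
Qed.

Lemma cyclic_intervalCE A : cyclic_interval (~: A) <-> cyclic_interval A.
Proof. by split=> /cyclic_intervalC; rewrite ?setCK. Qed.

Lemma ord_interval_cyclic A : ord_interval A -> cyclic_interval A.
Proof.
have [-> _|[w wA]] := set_0Vmem A.
  by apply: (@cyclic_intervalI 0 ord0) => //; apply/setP => x; rewrite !inE.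
case: (arg_minnP val wA) (arg_maxnP val wA) => lo loA le_lo [hi hiA le_hi] ivA.
have [lt_hi lt_lo] := (ltn_ord hi, ltn_ord lo).
apply: (@cyclic_intervalI (hi - lo).+1 lo); first by rewrite /=; lia.
apply/setP => x; rewrite in_cyc_interval; apply/idP/idP => [xA|].
  by have := le_hi x xA; have := le_lo x xA => /= ->; lia.
case: (leqP lo x) => [le_lox le_xhi|]; last by lia.
have [->//|ne_lo] := eqVneq x lo; have [->//|ne_hi] := eqVneq x hi.
apply/negPn/negP => /ivA/(_ loA hiA).
by move: ne_lo ne_hi; rewrite -!val_eqE /=; lia.
Qed.

Lemma cyclic_interval_no_max A :
  ord_max \notin A -> cyclic_interval A <-> ord_interval A.
Proof.
move=> maxA; split=> [[a eA] x y z|]; last exact: ord_interval_cyclic.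
move: maxA; rewrite eA !in_cyc_interval leq_ord /=.
have := ltn_ord x; have := ltn_ord y; have := ltn_ord z; have := ltn_ord a.
by case: (leqP a x) => ?; case: (leqP a y) => ?; case: (leqP a z) => ?; lia.
Qed.

End CyclicIntervals.

(** * Arc permutations *)

Section ArcPermutations.
Variable n : nat.
Implicit Types (c i j p q r : 'I_n.+1) (J : {set 'I_n.+1}) (pi : 'S_n.+1).

Definition prefix_set pi (k : nat) : {set 'I_n.+1} :=
  [set pi p | p : 'I_n.+1 & p < k].

Lemma mem_prefix_set pi k p : (pi p \in prefix_set pi k) = (p < k).
Proof. by rewrite (mem_imset _ _ (@perm_inj _ pi)) inE. Qed.

Lemma card_prefix_set pi k : k <= n.+1 -> #|prefix_set pi k| = k.
Proof.
move=> le_kn; rewrite card_imset; last exact: perm_inj.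
by rewrite -[RHS](card_ord_lt le_kn); apply: eq_card => x; rewrite !inE.
Qed.

Lemma is_arcP pi :
  reflect (forall k, 0 < k <= n.+1 -> cyclic_interval (prefix_set pi k))
          (is_arc pi).
Proof.
apply: (iffP forallP) => [arc k /andP[k_gt0 le_kn]|arc k].
  have /implyP/(_ k_gt0)/existsP[a /eqP] := arc (Ordinal (le_kn : k < n.+2)).
  exact: cyclic_intervalI.
apply/implyP => k_gt0; have [|a eq_a] := arc k; first by rewrite k_gt0 leq_ord.
apply/existsP; exists a.
by rewrite -/(prefix_set pi k) {1}eq_a card_prefix_set ?leq_ord.
Qed.

Lemma is_arc_intervalP pi c : pi c = ord_max ->
  reflect (forall k, 0 < k <= n.+1 -> ord_interval
             (if k <= c then prefix_set pi k else ~: prefix_set pi k))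
          (is_arc pi).
Proof.
move=> max_c.
have cycE k : cyclic_interval (prefix_set pi k) <->
    ord_interval (if k <= c then prefix_set pi k else ~: prefix_set pi k).
  case: leqP => [le_kc|lt_ck].
    by apply: cyclic_interval_no_max; rewrite -max_c mem_prefix_set -leqNgt.
  apply: iff_trans (iff_sym (cyclic_intervalCE _)) (cyclic_interval_no_max _).
  by rewrite -max_c in_setC mem_prefix_set lt_ck.
by apply: (iffP (is_arcP pi)) => arc k /arc/cycE.
Qed.

(* Here and below, [lt i j] is only meaningful for [i < j]. *)
Definition arc_order c (lt : rel 'I_n.+1) : Prop :=
  (forall p q r, p < minn c r -> q < minn c r -> lt p r = lt q r) /\
  (forall p q r, maxn c p < q -> maxn c p < r -> lt p q = lt p r).

Lemma is_arc_orderP pi c : pi c = ord_max ->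
  is_arc pi <-> arc_order c (fun i j => pi i < pi j).
Proof.
move=> max_c; split=> [/(is_arc_intervalP max_c) arc|[pre suf]].
  split=> p q r lt_p lt_q.
    have ivl : ord_interval (prefix_set pi (minn c r)).
      have := arc (minn c r); rewrite geq_minl; apply.
      by have := ltn_ord c; lia.
    by apply: ivl; rewrite mem_prefix_set // -leqNgt geq_minr.
  have ivl : ord_interval (~: prefix_set pi (maxn c p).+1).
    have := arc (maxn c p).+1; case: (leqP _ c) => [|_]; first by lia.
    by apply; have := ltn_ord q; lia.
  have [lt_pq lt_pr] : p < q /\ p < r by split; lia.
  apply: negb_inj; rewrite -!perm_gtE //.
  by apply: ivl; rewrite in_setC mem_prefix_set; lia.
apply/(is_arc_intervalP max_c) => k _ x y z.
rewrite -(permKV pi x) -(permKV pi y) -(permKV pi z).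
move: (pi^-1 x)%g (pi^-1 y)%g (pi^-1 z)%g => r p q.
case: (leqP k c) => [le_kc|lt_ck]; rewrite ?in_setC !mem_prefix_set -?leqNgt.
  by move=> le_kr lt_pk lt_qk; apply: pre; lia.
rewrite -ltnNge => lt_rk le_kp le_kq.
rewrite (perm_gtE pi (leq_trans lt_rk le_kp)).
rewrite (perm_gtE pi (leq_trans lt_rk le_kq)).
by congr (~~ _); apply: suf; lia.
Qed.

Definition rel_cDes (lt : rel 'I_n.+1) : {set 'I_n.+1} :=
  [set p | if p == ord_max then lt ord0 p else ~~ lt p (ordS p)].

Lemma eq_rel_cDes (lt lt' : rel 'I_n.+1) : 0 < n ->
  (forall i j, i < j -> lt i j = lt' i j) -> rel_cDes lt = rel_cDes lt'.
Proof.
move=> n_gt0 eq_lt; apply/setP => p; rewrite !inE.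
by have [->|ne_p] := eqVneq p ord_max; rewrite eq_lt ?val_ordS_neq_max.
Qed.

Lemma cDes_permE pi : 0 < n -> cDes_perm pi = rel_cDes (fun i j => pi i < pi j).
Proof.
move=> n_gt0; apply/setP => p; rewrite !inE.
have [->|ne_p] := eqVneq p ord_max; first by rewrite ordS_max.
by apply: perm_gtE; rewrite val_ordS_neq_max.
Qed.

Definition arc_asc c J i j : bool :=
  if j <= c then ord_pred j \notin J
  else if c <= i then i \notin J else ord_max \in J.

Lemma arc_asc_order c J : arc_order c (arc_asc c J).
Proof.
rewrite /arc_asc; split=> p q r; rewrite ?leq_min ?gtn_max.
  by move=> /andP[lt_pc _] /andP[lt_qc _]; rewrite !(leqNgt c) lt_pc lt_qc.
by move=> /andP[lt_cq _] /andP[lt_cr _]; rewrite !(leqNgt _ c) lt_cq lt_cr.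
Qed.

Lemma arc_order_ltE c (lt : rel 'I_n.+1) i j : 0 < n -> arc_order c lt ->
  i < j -> lt i j = arc_asc c (rel_cDes lt) i j.
Proof.
move=> n_gt0 [pre suf] lt_ij; rewrite /arc_asc !inE eqxx.
have le_jn := leq_ord j.
case: (leqP j c) => [le_jc|lt_cj].
  have val_pj := val_ord_pred_gt0 (leq_ltn_trans (leq0n i) lt_ij).
  rewrite ord_pred_eq_max ord_predK -val_eqE /= gtn_eqF; last by lia.
  by rewrite negbK; apply: pre; rewrite ?val_pj; lia.
case: (leqP c i) => [le_ci|lt_ic].
  have ne_i : i != ord_max by rewrite -val_eqE /=; lia.
  rewrite (negbTE ne_i) negbK.
  by apply: suf; rewrite ?val_ordS_neq_max //; lia.
by rewrite (pre i ord0 j) ?(suf ord0 j ord_max) //=; lia.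
Qed.

Definition run_start c J : bool := (c \in J) && (ord_pred c \notin J).

Lemma card_run_start c J : run_start c J -> 0 < #|J| <= n.
Proof.
case/andP => cJ /card_ord_notin; rewrite ltnS => ->; rewrite andbT.
by apply/card_gt0P; exists c.
Qed.

Lemma arc_asc_cDes c J : 0 < n -> run_start c J -> rel_cDes (arc_asc c J) = J.
Proof.
move=> n_gt0 /andP[cJ pcJ]; apply/setP => p; rewrite inE /arc_asc.
have [->|ne_p] := eqVneq p ord_max; last first.
  by rewrite ordSK val_ordS_neq_max //; case: (ltnP p c) => _; rewrite negbK.
case: (leqP ord_max c) => [le_nc|_].
  have eq_c : c = ord_max by apply/val_inj/anti_leq; rewrite leq_ord.
  by rewrite -eq_c cJ pcJ.
case: leqP => // le_c0.
have eq_c : c = ord0 by apply/val_inj/eqP; rewrite -leqn0.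
by move: cJ pcJ; rewrite eq_c ord_pred0 => -> /negbTE ->.
Qed.

(* The positions on either side of [c] get a block of keys each, the relative
   position of the blocks being given by [ord_max \in J].  Within a block the
   keys move away from [n.+1] as the positions approach [c], so that each is
   a new minimum or a new maximum. *)
Definition arc_key c J i : nat :=
  if i == c then 4 * n.+1
  else if i < c then
    (if ord_max \in J then 0 else 2 * n.+1) +
    (if ord_pred i \in J then n.+1 - i else n.+1 + i)
  else
    (if ord_max \in J then 2 * n.+1 else 0) +
    (if i \in J then 2 * n.+1 - i else i).

Lemma arc_key_lt c J i j : run_start c J -> i < j ->
  (arc_key c J i < arc_key c J j) = arc_asc c J i j.
Proof.
move=> /andP[cJ pcJ] lt_ij; rewrite /arc_key /arc_asc -!val_eqE /=.
have lt_jn := ltn_ord j; case: (ltngtP i c) => [lt_ic|lt_ci|/val_inj eq_ic].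
- case: (ltngtP j c) => [lt_jc|lt_cj|/val_inj ->].
  + by do ?case: ifP; lia.
  + by do ?case: ifP; lia.
  + by rewrite pcJ; do ?case: ifP; lia.
- case: (ltngtP j c) => [|_|]; try lia.
  by do ?case: ifP; lia.
- rewrite eq_ic cJ /= in lt_ij *; case: (ltngtP j c) => [|_|]; try lia.
  by do ?case: ifP; lia.
Qed.

Lemma arc_key_inj c J : injective (arc_key c J).
Proof.
move=> i j; rewrite /arc_key; have [lt_in lt_jn] := (ltn_ord i, ltn_ord j).
move=> eq_ij; apply: val_inj; move: eq_ij; rewrite -!val_eqE /=.
by case: (ltngtP i c) => ?; case: (ltngtP j c) => ?; do ?case: ifP => _; lia.
Qed.

Lemma exists_arc c J : 0 < n -> run_start c J ->
  exists pi, [/\ is_arc pi, pi c = ord_max & cDes_perm pi = J].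
Proof.
move=> n_gt0 run; have [pi lt_pi] := exists_standardization (@arc_key_inj c J).
have max_c : pi c = ord_max.
  apply: perm_eq_max => i ne_ic; rewrite lt_pi /arc_key eqxx (negbTE ne_ic).
  by move: ne_ic; rewrite -val_eqE /=; have := ltn_ord i; do ?case: ifP; lia.
have asc i j : i < j -> (pi i < pi j) = arc_asc c J i j.
  by move=> lt_ij; rewrite lt_pi arc_key_lt.
exists pi; split=> //.
  apply/(is_arc_orderP max_c); have [pre suf] := arc_asc_order c J.
  split=> p q r lt_p lt_q; rewrite !asc; try lia; first exact: pre.
  exact: suf.
by rewrite cDes_permE // (eq_rel_cDes n_gt0 asc) arc_asc_cDes.
Qed.

Lemma arc_inj pi sigma c : 0 < n -> is_arc pi -> is_arc sigma ->
  pi c = ord_max -> sigma c = ord_max -> cDes_perm pi = cDes_perm sigma ->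
  pi = sigma.
Proof.
move=> n_gt0 arc_pi arc_sigma pi_c sigma_c eq_cDes.
have lt_asc (tau : 'S_n.+1) i j : is_arc tau -> tau c = ord_max -> i < j ->
    (tau i < tau j) = arc_asc c (cDes_perm tau) i j.
  move=> arc_tau tau_c lt_ij; rewrite cDes_permE //.
  exact: (arc_order_ltE n_gt0 (iffLR (is_arc_orderP tau_c) arc_tau) lt_ij).
by apply: perm_lt_inj => i j lt_ij; rewrite !lt_asc // eq_cDes.
Qed.

Lemma run_start_cDes_perm pi c :
  0 < n -> pi c = ord_max -> run_start c (cDes_perm pi).
Proof.
move=> n_gt0 max_c; rewrite /run_start !inE ord_predK max_c /=.
rewrite -leqNgt leq_ord andbT ltn_neqAle leq_ord andbT.
rewrite -[X in _ != X](_ : pi c = n :> nat); last by rewrite max_c.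
by rewrite val_eqE (inj_eq perm_inj) ordS_neq.
Qed.

Lemma sum_arc_run_start (V : nmodType) (F : {set 'I_n.+1} -> V) : 0 < n ->
  (\sum_(pi : 'S_n.+1 | is_arc pi) F (cDes_perm pi)
   = \sum_(u : 'I_n.+1 * {set 'I_n.+1} | run_start u.1 u.2) F u.2)%R.
Proof.
move=> n_gt0; rewrite -big_enum /=.
pose top_cDes pi := ((pi^-1)%g ord_max, cDes_perm pi).
have max_top pi : pi (top_cDes pi).1 = ord_max by rewrite permKV.
apply: (@big_inj_image _ _ _ _ _ _ _ top_cDes (fun u => F u.2)).
- exact: enum_uniq.
- move=> pi sigma; rewrite !mem_enum => arc_pi arc_sigma [eq_top eq_cDes].
  apply: (arc_inj n_gt0 arc_pi arc_sigma (max_top pi)) => //.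
  by rewrite /= eq_top permKV.
- case=> c J; apply: (iffP idP) => [/= run|[pi _ ->]].
    have [pi [arc_pi max_c eq_J]] := exists_arc n_gt0 run.
    by exists pi; rewrite ?mem_enum // /top_cDes eq_J -max_c permK.
  exact: run_start_cDes_perm.
Qed.

End ArcPermutations.

(** * Shuffles *)

Section Shuffles.
Variables (T K : eqType) (f : T -> K).
Implicit Types (s t : seq T) (w : seq K).

Definition block s (y : K) : seq T := [seq x <- s | f x == y].

Lemma eq_shuffle s t : map f s = map f t -> block s =1 block t -> s = t.
Proof.
elim: s t => [|x s IHs] [|y t] //= [eq_f eq_map] eq_block.
have [eq_xy _] : x = y /\ block s (f x) = block t (f x).
  by have := eq_block (f x); rewrite /block /= -eq_f eqxx => -[].
rewrite eq_xy; congr cons; apply: IHs => // z.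
by have := eq_block z; rewrite /block /= eq_f; case: ifP => // _ [].
Qed.

Lemma exists_shuffle s w : perm_eq w (map f s) ->
  exists t, [/\ perm_eq t s, map f t = w & block t =1 block s].
Proof.
elim: w s => [|y w IHw] s.
  by rewrite perm_sym => /perm_nilP; case: s => // _; exists [::].
move=> eq_ws; have s_y : has (fun x => f x == y) s.
  rewrite -[has _ _](has_map f (pred1 y)) has_pred1.
  by rewrite -(perm_mem eq_ws) mem_head.
case: (split_find s_y) eq_ws => x s1 s2 /eqP fx s1_y eq_ws.
have perm_x : perm_eq (rcons s1 x ++ s2) (x :: s1 ++ s2).
  by rewrite cat_rcons (perm_catCA s1 [:: x]).
have [|t [eq_ts map_t block_t]] := IHw (s1 ++ s2).
  rewrite -(perm_cons y) -{2}fx.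
  exact: perm_trans eq_ws (perm_map f perm_x).
exists (x :: t); split.
- by rewrite perm_sym (perm_trans perm_x) // perm_cons perm_sym.
- by rewrite /= fx map_t.
move=> z; have := block_t z.
rewrite /block /= !filter_cat filter_rcons fx => ->.
case: (y =P z) => [<-|] //; rewrite cat_rcons.
by move: s1_y; rewrite has_filter negbK => /eqP ->.
Qed.

Lemma pairwise_blocks (r : rel T) s : (forall y, pairwise r (block s y)) ->
  pairwise (fun x y => (f x == f y) ==> r x y) s.
Proof.
elim: s => //= x s IHs r_block; rewrite IHs ?andbT => [|y]; last first.
  by have := r_block y; rewrite /block /=; case: ifP => //= _ /andP[].
apply/allP => z zs; apply/implyP => eq_f.
have := r_block (f x); rewrite /block /= eqxx /= => /andP[/allP + _]; apply.
by rewrite mem_filter eq_sym eq_f.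
Qed.

End Shuffles.

(** * Tableaux of shape hook plus one cell *)

Section CyclicDescentsOfLegs.
Variable n : nat.
Implicit Types (c i : 'I_n.+1) (J L : {set 'I_n.+1}).

(* A non-maximal entry [i != c] is a descent iff [i + 1] is in the leg, while
   the maximal entry is a cyclic descent iff it is [c] or [c + 1] is in the leg;
   the transposition merges the two rules. *)
Definition cDes_of_legs c L : {set 'I_n.+1} :=
  c |: [set i | ordS (tperm c ord_max i) \in L].

Definition legs_of_cDes c J : {set 'I_n.+1} :=
  [set i | (i != ord0) && (tperm c ord_max (ord_pred i) \in J)].

Lemma cDes_of_legsK c L :
  ord0 \notin L -> legs_of_cDes c (cDes_of_legs c L) = L.
Proof.
move=> L0; apply/setP => i; rewrite !inE tpermK ord_predK.
rewrite (canF_eq (tpermK _ _)) tpermL ord_pred_eq_max.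
by case: eqVneq => //= ->; rewrite (negbTE L0).
Qed.

Lemma legs_of_cDesK c J :
  c \in J -> cDes_of_legs c (legs_of_cDes c J) = J.
Proof.
move=> cJ; apply/setP => i; rewrite !inE ordSK tpermK ordS_eq0.
rewrite (canF_eq (tpermK _ _)) tpermR.
by case: eqVneq => //= ->.
Qed.

Lemma card_cDes_of_legs c L : ord0 \notin L -> #|cDes_of_legs c L| = #|L|.+1.
Proof.
move=> L0; rewrite cardsU1 inE tpermL ordS_max L0 add1n; congr _.+1.
have shift_inj : injective (fun i => ordS (tperm c ord_max i)).
  by move=> i j /ordS_inj/perm_inj.
by rewrite -(card_preimset L shift_inj).
Qed.

(* The smallest entry of the hook sits in its corner, hence not in the leg. *)
Definition leg_entries c L : bool :=
  [&& ord0 \notin L, c \notin L & (c == ord0) ==> (ordS c \notin L)].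

Lemma run_start_cDes_of_legs c L : 0 < n -> ord0 \notin L ->
  run_start c (cDes_of_legs c L) = leg_entries c L.
Proof.
move=> n_gt0 L0; rewrite /run_start /leg_entries L0 !inE eqxx /=.
have ne_pc : ord_pred c != c.
  by rewrite -{2}(ord_predK c) eq_sym ordS_neq.
rewrite (negbTE ne_pc) /=; have [->|ne_c0] /= := eqVneq c ord0.
  by rewrite ord_pred0 tpermR L0.
rewrite tpermD ?andbT; first by rewrite ord_predK.
  by rewrite eq_sym.
by rewrite eq_sym ord_pred_eq_max.
Qed.

Lemma leg_entries_of_cDes c J : 0 < n -> run_start c J ->
  leg_entries c (legs_of_cDes c J).
Proof.
move=> n_gt0 run; have /andP[cJ _] := run.
by rewrite -run_start_cDes_of_legs ?legs_of_cDesK // !inE eqxx.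
Qed.

Lemma exists_arm_before_legs c L : 0 < n -> leg_entries c L ->
  exists e, [/\ e != c, e \notin L & forall i, i != c -> i \in L -> e < i].
Proof.
move=> n_gt0 /and3P[L0 _ LS].
have [c0|ne_c0] := eqVneq c ord0; last first.
  exists ord0; split=> // [|i _ iL]; first by rewrite eq_sym.
  have : i != ord0 by apply: contraNneq L0 => <-.
  by rewrite -val_eqE lt0n.
rewrite c0 eqxx /= in LS *; exists (ordS ord0); split; rewrite ?ordS_neq //.
move=> i ne_i0 iL; have : i != ordS ord0 by apply: contraNneq LS => <-.
by move: ne_i0; rewrite -!val_eqE /= modn_small //; lia.
Qed.

End CyclicDescentsOfLegs.

Section StandardTableaux.
Local Notation x0 := (0, 0).
Implicit Types (x y : cell) (s cells : seq cell).

Definition cell_lt x y : bool :=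
  (x.1 == y.1) && (x.2 < y.2) || (x.2 == y.2) && (x.1 < y.1).

Lemma is_standardE cells s :
  is_standard cells s =
    perm_eq s cells && pairwise (fun x y => ~~ cell_lt y x) s.
Proof.
congr andb; apply/forallP/(pairwiseP x0) => [inc i j lt_is lt_js lt_ij|std i].
  have /forallP/(_ (Ordinal lt_is)) := inc (Ordinal lt_js).
  by rewrite /cell_lt /=; move: lt_ij; lia.
apply/forallP => j /=; have [lt_is lt_js] := (ltn_ord i, ltn_ord j).
have [_|lt_ji|/val_inj ->] := ltngtP i j.
- by rewrite !implybT.
- by have := std j i lt_js lt_is lt_ji; rewrite /cell_lt; lia.
- by rewrite !ltnn !andbF.
Qed.

Lemma mem_SYT cells s : (s \in SYT cells) = is_standard cells s.
Proof. by rewrite mem_filter mem_permutations andb_idr // => /andP[]. Qed.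

Lemma standard_nth cells s i j : is_standard cells s ->
  i < j < size s -> ~~ cell_lt (nth x0 s j) (nth x0 s i).
Proof.
rewrite is_standardE => /andP[_ /(pairwiseP x0) std] /andP[lt_ij lt_js].
by apply: std => //; apply: ltn_trans lt_js.
Qed.

(* As [#|D| = k + 1], the descents below the maximal entry number [k] exactly
   when the maximal entry is in [D]. *)
Lemma cDes_tab_eq n k s (D : {set 'I_n.+1}) : size s = n.+1 -> #|D| = k.+1 ->
  (forall i : 'I_n.+1, i < n ->
     ((nth x0 s i).1 < (nth x0 s i.+1).1) = (i \in D)) ->
  cDes_tab n.+1 k s = D.
Proof.
move=> size_s card_D desE.
have mem_Des i : (nat_of_ord i \in Des_tab s) = (i \in D :\ ord_max).
  rewrite mem_filter mem_iota size_s !inE -val_eqE /=.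
  case: (ltngtP i n) (leq_ord i) => [lt_in|//|->] _; last by rewrite andbF.
  by rewrite desE // andbT.
have size_Des : (size (Des_tab s) == k) = (ord_max \in D).
  suff -> : size (Des_tab s) = #|D :\ ord_max|.
    rewrite -eqSS -card_D (cardsD1 ord_max D) -add1n eqn_add2r.
    by case: (_ \in D).
  rewrite cardE -(size_map val); apply/perm_size/uniq_perm.
  - exact/filter_uniq/iota_uniq.
  - by rewrite (map_inj_uniq val_inj) enum_uniq.
  move=> a; apply/idP/mapP => [Des_a|[i + ->]].
    have lt_an : a < n.+1.
      by move: Des_a; rewrite mem_filter mem_iota size_s /=; lia.
    by exists (Ordinal lt_an); rewrite // mem_enum -mem_Des.
  by rewrite mem_enum -mem_Des.
apply/setP => i; rewrite inE mem_Des size_Des !inE.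
rewrite -[_ == n.+1.-1]/(i == ord_max).
by case: eqVneq => [->|_] //=; rewrite orbF.
Qed.

End StandardTableaux.

Section HookTableaux.
Variables n k : nat.
Hypothesis lt_kn : k < n.
Local Notation x0 := (0, 0).
Local Notation hook := (hook_plus_cell n.+1 k).
Implicit Types (x y : cell) (c i j : 'I_n.+1) (L : {set 'I_n.+1}).
Implicit Types s t : seq cell.

Lemma mem_hook x : (x \in hook) =
  [|| x == (0, n - k), (x.1 == 1) && (x.2 < n - k)
    | (1 < x.1 < k.+2) && (x.2 == 0)].
Proof.
case: x => r q; rewrite inE mem_cat subSn ?(ltnW lt_kn) // subn1 /=.
congr (_ || (_ || _)).
  apply/mapP/andP => [[p + [-> ->]]|[/eqP -> lt_q]].
    by rewrite mem_iota; split.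
  by exists q; rewrite // mem_iota.
apply/mapP/andP => [[p + [-> ->]]|[lt_r /eqP ->]].
  by rewrite mem_iota; split.
by exists r; rewrite // mem_iota.
Qed.

Lemma lone_cell_hook : (0, n - k) \in hook.
Proof. by rewrite mem_hook eqxx. Qed.

Lemma corner_hook : (1, 0) \in hook.
Proof. by rewrite mem_hook /=; lia. Qed.

Lemma size_hook : size hook = n.+1.
Proof. by rewrite /= size_cat !size_map !size_iota; lia. Qed.

Lemma pairwise_reading_order_hook :
  pairwise (fun x y => (x.1 < y.1) || (x.1 == y.1) && (x.2 < y.2)) hook.
Proof.
have iota_lt p q : pairwise ltn (iota p q).
  by rewrite -sorted_pairwise ?iota_ltn_sorted //; exact: ltn_trans.
rewrite /= all_cat !all_map pairwise_cat !pairwise_map -andbA.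
apply/and5P; split.
- exact/allP.
- by apply/allP => p; rewrite mem_iota /=; lia.
- apply/allrelP => _ _ /mapP[p + ->] /mapP[q + ->].
  by rewrite !mem_iota /=; lia.
- exact: sub_pairwise (iota_lt _ _).
- by apply: sub_pairwise (iota_lt _ _) => p q /= ->.
Qed.

Lemma hook_uniq : uniq hook.
Proof.
by apply: pairwise_uniq pairwise_reading_order_hook => x; rewrite !ltnn andbF.
Qed.

Lemma hook_pairwise : pairwise (fun x y => ~~ cell_lt y x) hook.
Proof.
apply: sub_pairwise pairwise_reading_order_hook => x y.
by rewrite /cell_lt; lia.
Qed.

(* [0] for the isolated cell, [1] for the arm (corner included), [2] for the
   leg. *)
Definition hook_part x : nat := minn x.1 2.

Lemma hook_part_chain x y : x \in hook -> y \in hook ->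
  hook_part x = hook_part y -> [|| x == y, cell_lt x y | cell_lt y x].
Proof.
rewrite !mem_hook /hook_part /cell_lt; case: x y => [r q] [r' q'].
by rewrite !xpair_eqE /=; lia.
Qed.

Lemma map_hook_part : map hook_part hook = 0 :: nseq (n - k) 1 ++ nseq k 2.
Proof.
rewrite /= map_cat -!map_comp subSn ?(ltnW lt_kn) // subn1 /=.
rewrite (@map_eq_nseq _ _ _ 1) ?(@map_eq_nseq _ _ _ 2) ?size_iota // => r.
by rewrite mem_iota /hook_part /=; lia.
Qed.

Definition hook_word c L : seq nat :=
  [seq if i == c then 0 else (i \in L).+1 | i <- enum 'I_n.+1].

Lemma perm_hook_word c L : c \notin L ->
  perm_eq (hook_word c L) (map hook_part hook) = (#|L| == k).
Proof.
move=> cL; pose A := ~: (c |: L).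
have card_A : #|A| = n - #|L|.
  have := cardsC (c |: L); rewrite cardsU1 cL card_ord => -[eq_n].
  by rewrite -[X in X - _]eq_n addKn.
have perm_enum : perm_eq (enum 'I_n.+1) (c :: enum A ++ enum L).
  apply: uniq_perm; first exact: enum_uniq.
    rewrite /= mem_cat !mem_enum !inE eqxx (negbTE cL).
    rewrite cat_uniq !enum_uniq andbT.
    by apply/hasPn => i; rewrite !mem_enum !inE => ->; rewrite orbT.
  move=> i; rewrite mem_enum !inE mem_cat !mem_enum !inE.
  by case: (i == c); case: (i \in L).
have perm_word :
    perm_eq (hook_word c L) (0 :: nseq (n - #|L|) 1 ++ nseq #|L| 2).
  rewrite (permPl (perm_map _ perm_enum)) /= eqxx map_cat -card_A !cardE.
  rewrite (@map_eq_nseq _ _ _ 1 (enum A)) ?(@map_eq_nseq _ _ _ 2 (enum L)) //.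
    by move=> i; rewrite mem_enum => iL; rewrite iL (negbTE (memPn cL i iL)).
  by move=> i; rewrite mem_enum !inE negb_or => /andP[/negbTE -> /negbTE ->].
rewrite (permPl perm_word) map_hook_part.
apply/idP/eqP => [/seq.permP/(_ (pred1 2))|->//].
by rewrite /= !count_cat !count_nseq /=; lia.
Qed.

Definition lone_entry s : 'I_n.+1 := inord (index (0, n - k) s).

Definition leg_set s : {set 'I_n.+1} := [set i : 'I_n.+1 | 1 < (nth x0 s i).1].

Section Standard.
Variable s : seq cell.
Hypothesis std_s : is_standard hook s.

Lemma perm_standard : perm_eq s hook.
Proof. by case/andP: std_s. Qed.

Lemma size_standard : size s = n.+1.
Proof. by rewrite (perm_size perm_standard) size_hook. Qed.

Lemma standard_uniq : uniq s.
Proof. by rewrite (perm_uniq perm_standard) hook_uniq. Qed.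

Lemma mem_nth_standard i : nth x0 s i \in hook.
Proof. by rewrite -(perm_mem perm_standard) mem_nth ?size_standard. Qed.

Lemma nth_standard_eq x i :
  x \in hook -> (nth x0 s i == x) = (i == index x s :> nat).
Proof.
rewrite -(perm_mem perm_standard) => sx; rewrite -{1}(nth_index x0 sx).
by rewrite nth_uniq ?standard_uniq ?index_mem // size_standard.
Qed.

Lemma row0_lone_entry i : ((nth x0 s i).1 == 0) = (i == lone_entry s).
Proof.
have -> : (i == lone_entry s) = (nth x0 s i == (0, n - k)).
  rewrite nth_standard_eq ?lone_cell_hook // -val_eqE /= inordK //.
  by rewrite -size_standard index_mem (perm_mem perm_standard) lone_cell_hook.
have := mem_nth_standard i; rewrite mem_hook.
by case: (nth x0 s i) => r q; rewrite xpair_eqE /=; lia.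
Qed.

Lemma map_hook_part_standard :
  map hook_part s = hook_word (lone_entry s) (leg_set s).
Proof.
apply: (@eq_from_nth _ 0) => [|a]; rewrite size_map size_standard.
  by rewrite size_map size_enum_ord.
move=> lt_an; rewrite (nth_map x0) ?size_standard //.
rewrite (nth_map ord0) ?size_enum_ord // -[a]/(val (Ordinal lt_an)).
rewrite nth_ord_enum -row0_lone_entry inE /hook_part.
by case: (nth x0 s _).1 => [|[|r]] //=; lia.
Qed.

(* Each block is a chain of cells, hence has a single linear extension. *)
Lemma block_standard : block hook_part s =1 block hook_part hook.
Proof.
move=> z; pose cell_le := [rel x y : cell | (x.1 <= y.1) && (x.2 <= y.2)].
have cell_le_asym : antisymmetric cell_le.
  by move=> [r q] [r' q'] /= le_xy; congr pair; lia.
have block_le t : perm_eq t hook -> pairwise (fun x y => ~~ cell_lt y x) t ->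
    pairwise cell_le (block hook_part t z).
  move=> perm_t nlt_t; pose in_block x := (x \in hook) && (hook_part x == z).
  apply: (@sub_in_pairwise _ in_block) (pairwise_filter _ nlt_t).
    move=> x y /andP[hx /eqP px] /andP[hy /eqP py].
    have := hook_part_chain hx hy (etrans px (esym py)).
    by case/or3P => [/eqP <- | | ->//]; rewrite /cell_lt /= ?leqnn //; lia.
  by apply/allP => x; rewrite mem_filter (perm_mem perm_t) andbC.
apply: (pairwise_eq cell_le_asym).
- by apply: block_le; move: std_s; rewrite is_standardE => /andP[].
- exact: block_le hook_pairwise.
- exact/perm_filter/perm_standard.
Qed.

Lemma corner_lt_leg i : i \in leg_set s -> index (1, 0) s < i.
Proof.
rewrite inE => leg_i; rewrite ltnNge leq_eqVlt -nth_standard_eq ?corner_hook //.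
apply/negP => /orP[/eqP eq_i|lt_i]; first by rewrite eq_i in leg_i.
have corner_s : (1, 0) \in s by rewrite (perm_mem perm_standard) corner_hook.
have := standard_nth (i := i) (j := index (1, 0) s) std_s.
rewrite lt_i index_mem corner_s nth_index // => /(_ isT).
have := mem_nth_standard i; rewrite mem_hook /cell_lt.
by case: (nth x0 s i) leg_i => r q; rewrite xpair_eqE /=; lia.
Qed.

Lemma leg_entries_standard : leg_entries (lone_entry s) (leg_set s).
Proof.
have := row0_lone_entry (lone_entry s); rewrite eqxx => row0.
apply/and3P; split.
- by apply/negP => /corner_lt_leg.
- by rewrite inE (eqP row0).
apply/implyP => /eqP lone0; rewrite lone0 in row0 *.
apply/negP => /corner_lt_leg; rewrite val_ordS; case: ifP => // _.
rewrite ltnS leqn0 => /eqP index_corner.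
have := nth_standard_eq ord0 corner_hook.
by rewrite index_corner eqxx => /eqP eq_corner; rewrite eq_corner in row0.
Qed.

Lemma card_leg_set : #|leg_set s| = k.
Proof.
have /and3P[_ cL _] := leg_entries_standard; apply/eqP.
by rewrite -(perm_hook_word cL) -map_hook_part_standard perm_map ?perm_standard.
Qed.

Lemma descent_standard i : i < n ->
  ((nth x0 s i).1 < (nth x0 s i.+1).1) =
  (i \in cDes_of_legs (lone_entry s) (leg_set s)).
Proof.
move=> lt_in; have ne_i : i != ord_max by rewrite -val_eqE /=; lia.
have val_Si := val_ordS_neq_max ne_i; rewrite -val_Si !inE.
have row0_i := row0_lone_entry i; have row0_Si := row0_lone_entry (ordS i).
have [eq_ic|ne_ic] := eqVneq i (lone_entry s); rewrite ?orTb ?orFb.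
  rewrite -eq_ic (negbTE (ordS_neq i _)) in row0_Si; last by lia.
  by move: row0_i; rewrite eq_ic eqxx => /eqP ->; rewrite lt0n -eq_ic row0_Si.
rewrite tpermD 1?eq_sym //.
have := standard_nth (i := i) (j := ordS i) std_s.
rewrite val_Si size_standard ltnSn ltnS lt_in -val_Si => /(_ isT).
have : nth x0 s i != nth x0 s (ordS i).
  by rewrite nth_uniq ?size_standard ?standard_uniq // val_Si ltn_eqF.
have := mem_nth_standard i; have := mem_nth_standard (ordS i).
rewrite !mem_hook.
move: row0_i; rewrite (negbTE ne_ic) /cell_lt.
case: (nth x0 s i) (nth x0 s (ordS i)) => [r q] [r' q'].
by rewrite !xpair_eqE /=; lia.
Qed.

Lemma cDes_standard :
  cDes_tab n.+1 k s = cDes_of_legs (lone_entry s) (leg_set s).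
Proof.
have /and3P[leg0 _ _] := leg_entries_standard.
apply: cDes_tab_eq size_standard _ descent_standard.
by rewrite card_cDes_of_legs // card_leg_set.
Qed.

End Standard.

Lemma standard_inj s t : is_standard hook s -> is_standard hook t ->
  lone_entry s = lone_entry t -> leg_set s = leg_set t -> s = t.
Proof.
move=> std_s std_t eq_lone eq_leg; apply: (@eq_shuffle _ _ hook_part).
  by rewrite !map_hook_part_standard // eq_lone eq_leg.
by move=> z; rewrite !block_standard.
Qed.

Lemma block_nth_not_lt s (i j : nat) :
  block hook_part s =1 block hook_part hook -> i < j < size s ->
  hook_part (nth x0 s i) = hook_part (nth x0 s j) ->
  ~~ cell_lt (nth x0 s j) (nth x0 s i).
Proof.
move=> block_s /andP[lt_ij lt_js] /eqP eq_part.
have nlt_block z : pairwise (fun x y => ~~ cell_lt y x) (block hook_part s z).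
  by rewrite block_s; apply: pairwise_filter hook_pairwise.
have /(pairwiseP x0)/(_ i j (ltn_trans lt_ij lt_js) lt_js lt_ij) :=
  pairwise_blocks nlt_block.
by rewrite eq_part.
Qed.

(* If [e] is the entry of an arm cell below all leg entries, then so is the
   entry of the corner, the first cell of the arm. *)
Lemma standard_of_blocks s e : perm_eq s hook ->
  block hook_part s =1 block hook_part hook -> hook_part (nth x0 s e) = 1 ->
  (forall i : nat, hook_part (nth x0 s i) = 2 -> e < i) -> is_standard hook s.
Proof.
move=> perm_s block_s part_e e_first; rewrite is_standardE perm_s.
have mem_s (i : nat) : i < size s -> nth x0 s i \in hook.
  by move=> lt_is; rewrite -(perm_mem perm_s) mem_nth.
apply/(pairwiseP x0) => i j; rewrite !inE => lt_is lt_js lt_ij.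
apply/negP => lt_cell.
have [|ne_part] := eqVneq (hook_part (nth x0 s i)) (hook_part (nth x0 s j)).
  by move/(block_nth_not_lt block_s); rewrite lt_ij lt_cell => /(_ lt_js).
have [corner_j leg_i] : nth x0 s j = (1, 0) /\ hook_part (nth x0 s i) = 2.
  move: (mem_s i lt_is) (mem_s j lt_js) ne_part lt_cell.
  rewrite !mem_hook /cell_lt /hook_part.
  case: (nth x0 s i) (nth x0 s j) => [r q] [r' q'].
  by rewrite !xpair_eqE /= => *; split; [congr pair|]; lia.
have lt_ej : e < j := ltn_trans (e_first i leg_i) lt_ij.
have lt_es := ltn_trans lt_ej lt_js.
have := block_nth_not_lt (i := e) (j := j) block_s.
rewrite lt_ej lt_js part_e corner_j => /(_ isT erefl).
have : nth x0 s e != nth x0 s j.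
  by rewrite nth_uniq ?(perm_uniq perm_s) ?hook_uniq ?ltn_eqF.
move: (mem_s e lt_es) part_e; rewrite corner_j mem_hook /cell_lt /hook_part.
by case: (nth x0 s e) => r q; rewrite !xpair_eqE /=; lia.
Qed.

Section OfWord.
Variables (s : seq cell) (c : 'I_n.+1) (L : {set 'I_n.+1}).
Hypothesis perm_s : perm_eq s hook.
Hypothesis word_s : map hook_part s = hook_word c L.

Lemma hook_part_nth i :
  hook_part (nth x0 s i) = if i == c then 0 else (i \in L).+1.
Proof.
rewrite -(nth_map x0 0) ?(perm_size perm_s) ?size_hook // word_s.
by rewrite (nth_map ord0) ?size_enum_ord // nth_ord_enum.
Qed.

Lemma lone_entry_of_word : lone_entry s = c.
Proof.
have lt_cs : c < size s by rewrite (perm_size perm_s) size_hook.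
have nth_c : nth x0 s c = (0, n - k).
  have : nth x0 s c \in hook by rewrite -(perm_mem perm_s) mem_nth.
  have := hook_part_nth c; rewrite eqxx mem_hook /hook_part.
  by case: (nth x0 s c) => r q; rewrite xpair_eqE /= => *; congr pair; lia.
rewrite /lone_entry -nth_c index_uniq ?inord_val //.
by rewrite (perm_uniq perm_s) hook_uniq.
Qed.

Lemma leg_set_of_word : c \notin L -> leg_set s = L.
Proof.
move=> cL; apply/setP => i; rewrite inE.
have := hook_part_nth i; rewrite /hook_part.
have [->|_] := eqVneq i c; first by rewrite (negbTE cL); lia.
by case: (i \in L) => /=; lia.
Qed.

End OfWord.

Lemma exists_standard c L : leg_entries c L -> #|L| = k ->
  exists s, [/\ is_standard hook s, lone_entry s = c & leg_set s = L].
Proof.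
move=> legs card_L; have /and3P[_ cL _] := legs.
have n_gt0 : 0 < n by apply: leq_ltn_trans lt_kn.
have [e [ne_ec eL e_first]] := exists_arm_before_legs n_gt0 legs.
have [|s [perm_s word_s block_s]] :=
  @exists_shuffle _ _ hook_part hook (hook_word c L).
  by rewrite perm_hook_word // card_L.
have part_s := hook_part_nth perm_s word_s.
exists s; split; last 2 first.
- exact: lone_entry_of_word perm_s word_s.
- exact: leg_set_of_word perm_s word_s cL.
apply: (@standard_of_blocks s e perm_s block_s) => [|a part_a].
  by rewrite part_s (negbTE ne_ec) (negbTE eL).
have lt_an : a < n.+1.
  rewrite ltnNge; apply/negP => le_na.
  by rewrite nth_default ?(perm_size perm_s) ?size_hook in part_a.
have := part_s (Ordinal lt_an); rewrite part_a; case: eqVneq => // ne_ac.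
by case aL: (_ \in L) => // _; apply: e_first aL.
Qed.

Lemma sum_SYT_run_start (V : nmodType) (F : {set 'I_n.+1} -> V) :
  (\sum_(s <- SYT hook) F (cDes_tab n.+1 k s)
   = \sum_(u : 'I_n.+1 * {set 'I_n.+1} |
           run_start u.1 u.2 && (#|u.2| == k.+1)) F u.2)%R.
Proof.
have n_gt0 : 0 < n by apply: leq_ltn_trans lt_kn.
pose lone_cDes s := (lone_entry s, cDes_tab n.+1 k s).
apply: (@big_inj_image _ _ _ _ _ _ _ lone_cDes (fun u => F u.2)).
- exact/filter_uniq/permutations_uniq.
- move=> s t; rewrite !mem_SYT => std_s std_t [eq_lone].
  have /and3P[s0 _ _] := leg_entries_standard std_s.
  have /and3P[t0 _ _] := leg_entries_standard std_t.
  rewrite !cDes_standard // => eq_cDes; apply: standard_inj => //.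
  by rewrite -(cDes_of_legsK (lone_entry s) s0) eq_cDes eq_lone cDes_of_legsK.
case=> c J; apply: (iffP andP) => [[/= run /eqP card_J]|[s]].
  have legs := leg_entries_of_cDes n_gt0 run; have /and3P[leg0 _ _] := legs.
  have /andP[cJ _] := run.
  have [|s [std_s lone_s leg_s]] := exists_standard legs.
    by apply: succn_inj; rewrite -(card_cDes_of_legs c leg0) legs_of_cDesK.
  exists s; rewrite ?mem_SYT // /lone_cDes cDes_standard // lone_s leg_s.
  by rewrite legs_of_cDesK.
rewrite mem_SYT => std_s [-> ->]; have legs := leg_entries_standard std_s.
have /and3P[leg0 _ _] := legs; rewrite cDes_standard //=; split.
  by rewrite run_start_cDes_of_legs.
by rewrite card_cDes_of_legs // card_leg_set.
Qed.

End HookTableaux.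

Local Open Scope ring_scope.

Theorem theorem6p11 (n : nat) (hn : (2 <= n)%N) :
  \sum_(pi : 'S_n | is_arc pi) xJ (cDes_perm pi)
  = \sum_(0 <= k < n.-1) \sum_(s <- SYT (hook_plus_cell n k)) xJ (cDes_tab n k s).
Proof.
case: n hn => // n; rewrite ltnS => n_gt0.
rewrite sum_arc_run_start // big_mkord /=.
rewrite (eq_bigr _ (fun (k : 'I_n) _ =>
  sum_SYT_run_start (ltn_ord k) (@xJ n.+1))).
rewrite (exchange_big_dep (fun u => run_start u.1 u.2)) /=; last first.
  by move=> k u _ /andP[].
apply: eq_bigr => u run; rewrite run /=.
have /andP[J_gt0 le_Jn] := card_run_start run.
have lt_Jn : (#|u.2|.-1 < n)%N by rewrite prednK.
rewrite (big_pred1 (Ordinal lt_Jn)) // => k.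
by rewrite -[RHS]/(k == #|u.2|.-1 :> nat) -[RHS]eqSS prednK // eq_sym.
Qed.
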